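(* Let $x\colon\mathbb{Z}^2\to\mathbb{R}^3$, $x(m,n)=\bigl(f(n)\cos\frac{2\pi m}{l},\,f(n)\sin\frac{2\pi m}{l},\,h(n)\bigr)$, be a discrete surface of revolution with unit normal $\nu(m,n)=\bigl(a(n)\cos\frac{2\pi m}{l},\,a(n)\sin\frac{2\pi m}{l},\,b(n)\bigr)$, and suppose it has constant Gaussian curvature $K=1$. Let $k_1\le 0\le k_2$ be integers and assume $f(n)\ge 0$ for all $k_1\le n\le k_2$. Suppose that $$f(0)=p,\quad h(0)=0,\quad a(0)=1,\quad b(0)=0,$$ and $$a(n)=\sqrt{1-p^2\sin^2 u_n},\qquad b(n)=p\sin u_n\qquad(k_1\le n\le k_2)$$ for some $p>0$ and some sequence of real numbers $-\pi/2\le u_{k_1}<\cdots<u_{-1}<u_0<u_1<\cdots<u_{k_2}\le \pi/2$. Then the profile curve of the surface is given by $$(f(n),h(n))=\Bigl(p\cos u_n,\ \sum_{i=1}^{n}\frac{(p\sin u_i-p\sin u_{i-1})(p\cos u_i-p\cos u_{i-1})}{\sqrt{1-p^2\sin^2u_i}-\sqrt{1-p^2\sin^2u_{i-1}}}\Bigr)\qquad(0<n\le k_2),$$ $$(f(n),h(n))=\Bigl(p\cos u_n,\ \sum_{i=1}^{-n}\frac{(p\sin u_{-i}-p\sin u_{-i+1})(p\cos u_{-i}-p\cos u_{-i+1})}{\sqrt{1-p^2\sin^2u_{-i}}-\sqrt{1-p^2\sin^2u_{-i+1}}}\Bigr)\qquad(k_1\le n<0).$$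
   Context: Here $f,h\colon\mathbb{Z}\to\mathbb{R}$ are functions with $(f(n),h(n))\ne(f(n+1),h(n+1))$ for all $n$, and $l$ is a positive integer (the number of divisions in the rotational direction). The profile curve is $n\mapsto(f(n),h(n))$. Unit normal: $a,b\colon\mathbb{Z}\to\mathbb{R}$ satisfy $a(n)^2+b(n)^2=1$ and, for every $n$, writing $\Delta f=f(n+1)-f(n)$ and $\Delta h=h(n+1)-h(n)$, $$a(n+1)=a(n)-\frac{2\,\Delta f\,(a(n)\Delta f+b(n)\Delta h)}{(\Delta f)^2+(\Delta h)^2},\qquad b(n+1)=b(n)-\frac{2\,\Delta h\,(a(n)\Delta f+b(n)\Delta h)}{(\Delta f)^2+(\Delta h)^2}.$$ That is, $(a(n+1),b(n+1))$ is the reflection of $(a(n),b(n))$ in the line through the origin orthogonal to the edge vector $(\Delta f,\Delta h)$. The normal at one index may be chosen freely and determines the others. Gaussian curvature: on the layer of faces between $n$ and $n+1$ it is $$K(n)=\frac{a(n+1)^2-a(n)^2}{f(n+1)^2-f(n)^2}.$$ The surface has constant Gaussian curvature $K=c$ if, for every $n$, this quotient is defined and equals $c$. The square roots in the statement are square roots of nonnegative reals; this is implicit in the assumption that $a(n)$ has the given form. *)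

(* Defs.v *)
From Stdlib Require Import Reals ZArith.
Open Scope R_scope.

(* The rotation by the angle [2 PI m / l] about the third axis, applied to the
   point [(r, 0, z)]. *)
Definition rotate (l m : Z) (r z : R) : R * R * R :=
  (r * cos (2 * PI * IZR m / IZR l), r * sin (2 * PI * IZR m / IZR l), z).

Definition surface_of_revolution (l : Z) (f h : Z -> R)
    (x : Z -> Z -> R * R * R) : Prop :=
  (0 < l)%Z /\
  (forall n : Z, (f n, h n) <> (f (n + 1)%Z, h (n + 1)%Z)) /\
  (forall m n : Z, x m n = rotate l m (f n) (h n)).

(* [(a (n+1), b (n+1))] is the reflection of [(a n, b n)] in the line through
   the origin orthogonal to the edge vector of the profile curve; the division
   is proper because consecutive points of the profile curve are distinct. *)
Definition profile_normal (f h a b : Z -> R) : Prop :=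
  forall n : Z,
    a n ^ 2 + b n ^ 2 = 1 /\
    let df := f (n + 1)%Z - f n in
    let dh := h (n + 1)%Z - h n in
    a (n + 1)%Z = a n - 2 * df * (a n * df + b n * dh) / (df ^ 2 + dh ^ 2) /\
    b (n + 1)%Z = b n - 2 * dh * (a n * df + b n * dh) / (df ^ 2 + dh ^ 2).

Definition unit_normal (l : Z) (f h a b : Z -> R)
    (nu : Z -> Z -> R * R * R) : Prop :=
  profile_normal f h a b /\
  (forall m n : Z, nu m n = rotate l m (a n) (b n)).

(* Curvature of the layer of faces between the parallels [n] and [n + 1]. *)
Definition gaussian_curvature (f a : Z -> R) (n : Z) : R :=
  (a (n + 1)%Z ^ 2 - a n ^ 2) / (f (n + 1)%Z ^ 2 - f n ^ 2).

(* Division by zero is total in [R], so that the quotient is defined has to be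
   required separately. *)
Definition constant_gaussian_curvature (f a : Z -> R) (c : R) : Prop :=
  forall n : Z,
    f (n + 1)%Z ^ 2 - f n ^ 2 <> 0 /\ gaussian_curvature f a n = c.

(* Main.v *)
(* [K = 1] makes [f ^ 2 - a ^ 2] constant along the profile curve, hence equal to
   its value [p ^ 2 - 1] at the index [0]; this gives [f = p cos u]. The normals
   at two consecutive indices are mirror images across the orthogonal complement
   of the edge, so their difference is parallel to the edge, whence
   [dh = db * df / da], and [h] is obtained by summation. *)

Require Import Defs.
From Stdlib Require Import Reals ZArith Lra Lia.
Open Scope R_scope.

(** The case [n = 0] has to be left out: the subtraction in [sum_f 1 0 t] truncates, so this sum is
    [t 1] rather than empty. The bound [N] confines the increments to the range where [a] and [b]
    are known explicitly. *)
Lemma sum_f_telescope (g t : nat -> R) (N : nat) :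
  g 0%nat = 0 ->
  (forall k : nat, (k < N)%nat -> g (S k) - g k = t (S k)) ->
  forall n : nat, (0 < n <= N)%nat -> g n = sum_f 1 n t.
Proof.
intros g0 step n [n_gt0 nN].
destruct n as [|n]; [lia|]; clear n_gt0.
unfold sum_f; replace (S n - 1)%nat with n by lia.
induction n as [|n IHn]; simpl.
- specialize (step 0%nat nN); lra.
- rewrite <- IHn by lia.
  replace (n + 1)%nat with (S n) by lia.
  specialize (step (S n) nN); lra.
Qed.

Lemma Z_constant_of_succ (A : Type) (g : Z -> A) :
  (forall n : Z, g (n + 1)%Z = g n) -> forall n : Z, g n = g 0%Z.
Proof.
intros step n; induction n using Z.peano_ind.
- reflexivity.
- now rewrite <- Z.add_1_r, step.
- rewrite <- IHn, <- (step (Z.pred n)).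
  now rewrite Z.add_1_r, Z.succ_pred.
Qed.

Lemma profile_normal_parallel (f h a b : Z -> R) (n : Z) :
  profile_normal f h a b ->
  (a (n + 1)%Z - a n) * (h (n + 1)%Z - h n) =
  (b (n + 1)%Z - b n) * (f (n + 1)%Z - f n).
Proof.
(* Both increments are the edge vector times one common scalar; its inverse is an atom for
   [ring]. *)
intros normal; destruct (normal n) as [_ [-> ->]]; unfold Rdiv; ring.
Qed.

Lemma constant_curvature_eq (f a : Z -> R) (c : R) (n : Z) :
  constant_gaussian_curvature f a c ->
  a (n + 1)%Z ^ 2 - a n ^ 2 = c * (f (n + 1)%Z ^ 2 - f n ^ 2).
Proof.
intros curv; destruct (curv n) as [df_neq0 <-].
unfold gaussian_curvature; now field.
Qed.

(** Nonzero curvature makes [a ^ 2] change wherever [f ^ 2] does, hence [a] changes too and the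
    parallelism relation can be divided by its increment. *)
Lemma height_increment (f h a b : Z -> R) (c : R) (n : Z) :
  profile_normal f h a b -> constant_gaussian_curvature f a c -> c <> 0 ->
  a (n + 1)%Z - a n <> 0 /\
  h (n + 1)%Z - h n =
  (b (n + 1)%Z - b n) * (f (n + 1)%Z - f n) / (a (n + 1)%Z - a n).
Proof.
intros normal curv c_neq0.
assert (da_neq0 : a (n + 1)%Z - a n <> 0).
{ intros da0.
  apply (Rmult_integral_contrapositive_currified _ _ c_neq0 (proj1 (curv n))).
  rewrite <- (constant_curvature_eq _ _ _ n curv).
  replace (a (n + 1)%Z) with (a n) by lra; ring. }
split; [exact da_neq0|].
rewrite <- (profile_normal_parallel _ h _ _ n normal); now field.
Qed.

Theorem theorem10 (l : Z) (f h a b : Z -> R) (x nu : Z -> Z -> R * R * R)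
    (k1 k2 : Z) (p : R) (u : Z -> R)
    (Hx : surface_of_revolution l f h x)
    (Hnu : unit_normal l f h a b nu)
    (HK : constant_gaussian_curvature f a 1)
    (Hk : (k1 <= 0 <= k2)%Z)
    (Hf : forall n : Z, (k1 <= n <= k2)%Z -> 0 <= f n)
    (Hf0 : f 0%Z = p) (Hh0 : h 0%Z = 0) (Ha0 : a 0%Z = 1) (Hb0 : b 0%Z = 0)
    (Hp : 0 < p)
    (Hu_bound : forall n : Z, (k1 <= n <= k2)%Z -> - (PI / 2) <= u n <= PI / 2)
    (Hu_incr : forall i j : Z, (k1 <= i)%Z -> (i < j)%Z -> (j <= k2)%Z ->
       u i < u j)
    (Hab : forall n : Z, (k1 <= n <= k2)%Z ->
       0 <= 1 - p ^ 2 * sin (u n) ^ 2 /\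
       a n = sqrt (1 - p ^ 2 * sin (u n) ^ 2) /\
       b n = p * sin (u n)) :
  (forall n : Z, (0 < n <= k2)%Z ->
     (f n, h n) =
     (p * cos (u n),
      sum_f 1 (Z.to_nat n) (fun k : nat =>
        let i := Z.of_nat k in
        (p * sin (u i) - p * sin (u (i - 1)%Z)) *
        (p * cos (u i) - p * cos (u (i - 1)%Z)) /
        (sqrt (1 - p ^ 2 * sin (u i) ^ 2)
         - sqrt (1 - p ^ 2 * sin (u (i - 1)%Z) ^ 2))))) /\
  (forall n : Z, (k1 <= n < 0)%Z ->
     (f n, h n) =
     (p * cos (u n),
      sum_f 1 (Z.to_nat (- n)) (fun k : nat =>
        let i := Z.of_nat k in
        (p * sin (u (- i)%Z) - p * sin (u (- i + 1)%Z)) *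
        (p * cos (u (- i)%Z) - p * cos (u (- i + 1)%Z)) /
        (sqrt (1 - p ^ 2 * sin (u (- i)%Z) ^ 2)
         - sqrt (1 - p ^ 2 * sin (u (- i + 1)%Z) ^ 2))))).
Proof.
destruct Hnu as [normal _].
assert (f2E : forall n : Z, f n ^ 2 - a n ^ 2 = p ^ 2 - 1).
{ intros n.
  rewrite (Z_constant_of_succ _ (fun n => f n ^ 2 - a n ^ 2)), Hf0, Ha0; [ring|].
  intros m; pose proof (constant_curvature_eq _ _ _ m HK); lra. }
assert (fE : forall n : Z, (k1 <= n <= k2)%Z -> f n = p * cos (u n)).
{ intros n n_in.
  destruct (Hab n n_in) as [sqrt_arg [aE _]].
  destruct (Hu_bound n n_in) as [u_ge u_le].
  assert (cos_ge0 : 0 <= cos (u n)) by (apply cos_ge_0; lra).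
  (* The invariant only gives [f n ^ 2 = p ^ 2 * cos (u n) ^ 2]; the sign is settled by [0 <= f n]
     and by [cos] being nonnegative on the interval containing [u n]. *)
  apply Rsqr_inj; [now apply Hf | apply Rmult_le_pos; lra |].
  specialize (f2E n); rewrite aE, pow2_sqrt in f2E by exact sqrt_arg.
  pose proof (sin2_cos2 (u n)) as trig; unfold Rsqr in *; nra. }
assert (aE : forall n : Z, (k1 <= n <= k2)%Z ->
    sqrt (1 - p ^ 2 * sin (u n) ^ 2) = a n)
  by (intros n n_in; symmetry; apply Hab, n_in).
assert (bE : forall n : Z, (k1 <= n <= k2)%Z -> p * sin (u n) = b n)
  by (intros n n_in; symmetry; apply Hab, n_in).
split; intros n n_in; (f_equal; [apply fE; lia|]).
- replace n with (Z.of_nat (Z.to_nat n)) at 1 by lia.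
  apply sum_f_telescope
    with (g := fun k => h (Z.of_nat k)) (N := Z.to_nat k2); [exact Hh0 | | lia].
  intros k k_lt; cbv zeta.
  replace (Z.of_nat (S k) - 1)%Z with (Z.of_nat k) by lia.
  (* Folding the explicit formulas back into [a], [b], [f] turns the summand into the quotient of
     [height_increment]. *)
  rewrite !aE, !bE, <- !fE by lia.
  replace (Z.of_nat (S k)) with (Z.of_nat k + 1)%Z by lia.
  apply (height_increment _ _ _ _ 1); [exact normal | exact HK | lra].
- replace n with (- Z.of_nat (Z.to_nat (- n)))%Z at 1 by lia.
  apply sum_f_telescope
    with (g := fun k => h (- Z.of_nat k)%Z) (N := Z.to_nat (- k1));
    [exact Hh0 | | lia].
  intros k k_lt; cbv zeta.
  rewrite !aE, !bE, <- !fE by lia.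
  replace (- Z.of_nat k)%Z with (- Z.of_nat (S k) + 1)%Z by lia.
  (* The sum descends from index 0, so each edge is traversed backwards: all four differences change
     sign, and so do both sides of the increment formula. *)
  destruct (height_increment f h a b 1 (- Z.of_nat (S k)) normal HK)
    as [da_neq0 dhE]; [lra|].
  rewrite <- Ropp_minus_distr, dhE; field; lra.
Qed.
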